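(* Let $G_1$ and $G_2$ be graphs with disjoint vertex sets. Then $\mathrm{compthin}(G_1\vee G_2)\leq \mathrm{compthin}(G_1)+\mathrm{compthin}(G_2)$ and $\mathrm{comppthin}(G_1\vee G_2)\leq \mathrm{comppthin}(G_1)+\mathrm{comppthin}(G_2)$. Moreover, if $G_2$ is complete, then $\mathrm{compthin}(G_1\vee G_2)=\mathrm{compthin}(G_1)$.
   Context: Graphs are finite, simple, undirected. The join $G_1\vee G_2$ has vertex set $V_1\cup V_2$ and edge set $E_1\cup E_2\cup\{vv': v\in V_1, v'\in V_2\}$. For a graph $G=(V,E)$, an ordering $v_1,\dots,v_n$ of $V$ and a partition of $V$ are consistent if for every $r<s<t$, whenever $v_r,v_s$ are in the same class and $v_tv_r\in E$, then $v_tv_s\in E$; they are strongly consistent if moreover for every $r<s<t$, whenever $v_s,v_t$ are in the same class and $v_tv_r\in E$, then $v_sv_r\in E$. $\mathrm{compthin}(G)$ is the minimum $k$ such that some ordering of $V$ and some partition of $V$ into $k$ cliques are consistent; $\mathrm{comppthin}(G)$ is defined likewise with strongly consistent. *)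

(* Defs.v *)
From mathcomp Require Import all_boot.
Set Implicit Arguments.
Unset Strict Implicit.
Unset Printing Implicit Defensive.

Record sgraph := SGraph {
  vertex :> finType;
  edge : rel vertex;
  edge_sym : symmetric edge;
  edge_irrefl : irreflexive edge }.

Definition complete (G : sgraph) : Prop :=
  forall x y : G, x != y -> edge x y.

Section Join.
Variables G1 G2 : sgraph.

(* The sum type makes the two vertex sets disjoint. *)
Definition join_edge : rel (G1 + G2) := fun u v =>
  match u, v with
  | inl x, inl y => edge x y
  | inr x, inr y => edge x y
  | _, _ => true
  end.

Lemma join_edge_sym : symmetric join_edge.
Proof. by case=> x [] y //=; rewrite edge_sym. Qed.

Lemma join_edge_irrefl : irreflexive join_edge.
Proof. by case=> x /=; rewrite edge_irrefl. Qed.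

Definition join : sgraph := SGraph join_edge_sym join_edge_irrefl.
End Join.

Section Thinness.
Variable G : sgraph.

Definition clique (B : {set G}) : bool :=
  [forall x in B, forall y in B, (x != y) ==> edge x y].

Definition clique_partition (P : {set {set G}}) : bool :=
  partition P [set: G] && [forall B in P, clique B].

Definition same_class (P : {set {set G}}) (x y : G) : bool :=
  pblock P x == pblock P y.

(* [v i] is the vertex in position [i]; injectivity of [v] makes it a
   bijection, as its domain has [#|G|] elements. *)
Definition ordering (v : {ffun 'I_#|G| -> G}) : bool := injectiveb v.

Definition consistent (v : {ffun 'I_#|G| -> G}) (P : {set {set G}}) : bool :=
  [forall r : 'I_#|G|, forall s : 'I_#|G|, forall t : 'I_#|G|,
     (r < s < t) ==>
     same_class P (v r) (v s) ==> edge (v t) (v r) ==> edge (v t) (v s)].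

Definition strongly_consistent (v : {ffun 'I_#|G| -> G}) (P : {set {set G}})
    : bool :=
  consistent v P &&
  [forall r : 'I_#|G|, forall s : 'I_#|G|, forall t : 'I_#|G|,
     (r < s < t) ==>
     same_class P (v s) (v t) ==> edge (v t) (v r) ==> edge (v s) (v r)].

Definition has_compthin (k : nat) : bool :=
  [exists v : {ffun 'I_#|G| -> G}, exists P : {set {set G}},
     [&& ordering v, clique_partition P, #|P| == k & consistent v P]].

Definition has_comppthin (k : nat) : bool :=
  [exists v : {ffun 'I_#|G| -> G}, exists P : {set {set G}},
     [&& ordering v, clique_partition P, #|P| == k & strongly_consistent v P]].

Lemma has_comppthin_card : has_comppthin #|G|.
Proof.
pose v : {ffun 'I_#|G| -> G} := [ffun i => enum_val i].
pose P : {set {set G}} := [set [set x] | x in [set: G]].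
have vI : injective v by move=> i j; rewrite !ffunE; apply: enum_val_inj.
have tP : trivIset P.
  apply/trivIsetP => _ _ /imsetP[x _ ->] /imsetP[y _ ->] ne.
  by rewrite disjoints1 inE; apply: contraNN ne => /eqP ->.
have pE x : pblock P x = [set x].
  by apply: def_pblock => //; [apply: imset_f; rewrite inE | rewrite inE].
have noclass (r s : 'I_#|G|) : r < s -> same_class P (v r) (v s) = false.
  move=> rs; apply/negP => /eqP; rewrite !pE => /set1_inj /vI e.
  by rewrite e ltnn in rs.
apply/existsP; exists v; apply/existsP; exists P; apply/and4P; split.
- exact/injectiveP.
- apply/andP; split; last first.
    apply/forall_inP => _ /imsetP[z _ ->].
    apply/forall_inP => x /set1P ->; apply/forall_inP => y /set1P ->.
    by rewrite eqxx.
  apply/and3P; split => //; last first.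
    by apply/negP => /imsetP[x _ /setP/(_ x)]; rewrite !inE eqxx.
  apply/eqP/setP => x; rewrite inE; apply/bigcupP; exists [set x].
    by apply: imset_f; rewrite inE.
  by rewrite inE.
- by rewrite card_imset ?cardsT //; apply: set1_inj.
- apply/andP; split; apply/forallP => r; apply/forallP => s; apply/forallP => t;
  by apply/implyP => /andP[rs st]; rewrite noclass.
Qed.

Lemma ex_comppthin : exists k, has_comppthin k.
Proof. by exists #|G|; apply: has_comppthin_card. Qed.

Lemma ex_compthin : exists k, has_compthin k.
Proof.
exists #|G|; have /existsP[v /existsP[P /and4P[ov cP kP /andP[c _]]]] :=
  has_comppthin_card.
by apply/existsP; exists v; apply/existsP; exists P; apply/and4P.
Qed.

Definition compthin : nat := ex_minn ex_compthin.

Definition comppthin : nat := ex_minn ex_comppthin.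

End Thinness.

(* Main.v *)
Require Import Defs.
From mathcomp Require Import all_boot.

(** An ordering together with a clique partition is the same thing as an
    injective ranking [rk : G -> nat] together with a colouring [c] whose colour
    classes are cliques. In this form all three claims are immediate: rank the
    vertices of [G1] before those of [G2]. For the inequalities use disjoint
    palettes; three vertices of the join that do not all lie on the same side
    satisfy the conditions because the two sides are completely joined. If [G2]
    is complete, give all of it the colour of a vertex of [G1]: the vertices of
    [G2] are universal and come last, so they impose no condition. Conversely a
    ranking and a colouring of the join restrict to [G1]. *)

Set Implicit Arguments.
Unset Strict Implicit.
Unset Printing Implicit Defensive.

Section Colorings.
Variables (G : sgraph) (T : eqType).
Implicit Types (rk : G -> nat) (c : G -> T).

Definition clique_coloring c : Prop :=
  forall x y, x != y -> c x = c y -> edge x y.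

Definition forward_consistent rk c : Prop :=
  forall x y z, rk x < rk y < rk z -> c x = c y -> edge z x -> edge z y.

Definition backward_consistent rk c : Prop :=
  forall x y z, rk x < rk y < rk z -> c y = c z -> edge z x -> edge y x.

End Colorings.

(** * Passing between orderings with clique partitions and rankings with colourings *)

Section Translation.
Variable G : sgraph.

(** This is the second conjunct of [strongly_consistent], isolated so that one translation serves
    both parameters. *)
Definition backward_consistentb (v : {ffun 'I_#|G| -> G}) (P : {set {set G}}) :
    bool :=
  [forall r : 'I_#|G|, forall s : 'I_#|G|, forall t : 'I_#|G|,
     (r < s < t) ==>
     same_class P (v s) (v t) ==> edge (v t) (v r) ==> edge (v s) (v r)].

Lemma ordering_rank (v : {ffun 'I_#|G| -> G}) :
  ordering v ->
  exists rk : G -> nat,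
    [/\ injective rk, forall i, rk (v i) = i & forall x, exists i, x = v i].
Proof.
move=> /injectiveP vI.
have v_onto x : x \in codom v by apply: inj_card_onto; rewrite ?card_ord.
exists (fun x => val (iinv (v_onto x))); split.
- by move=> x y /val_inj e; rewrite -(f_iinv (v_onto x)) e f_iinv.
- by move=> i; congr val; apply: vI; rewrite f_iinv.
- by move=> x; exists (iinv (v_onto x)); rewrite f_iinv.
Qed.

Lemma rank_ordering (rk : G -> nat) :
  injective rk ->
  exists2 v : {ffun 'I_#|G| -> G}, ordering v &
    {homo v : i j / i < j >-> rk i < rk j}.
Proof.
move=> rkI; pose s := sort (relpre rk leq) (enum G).
have sz : size s = #|G| by rewrite size_sort -cardE.
(* Distinct ranks turn weak sortedness into strict sortedness. *)
have ss : sorted (relpre rk ltn) s.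
  rewrite -sorted_map ltn_sorted_uniq_leq map_inj_uniq // sort_uniq.
  rewrite enum_uniq sorted_map; apply: sort_sorted => x y; exact: leq_total.
(* The default [enum_val i] is never returned, since [s] has length [#|G|]; it only supplies some
   element of [G]. *)
pose v : {ffun 'I_#|G| -> G} := [ffun i => nth (enum_val i) s i].
have vE (i : 'I_#|G|) x : v i = nth x s i.
  by rewrite ffunE; apply: set_nth_default; rewrite sz.
have vlt : {homo v : i j / i < j >-> rk i < rk j}.
  move=> i j ij; rewrite (vE i (v i)) (vE j (v i)).
  apply: (sorted_ltn_nth _ (leT := relpre rk ltn)) => //; rewrite ?inE ?sz //.
  by move=> x y z /=; apply: ltn_trans.
exists v => //; apply/injectiveP => i j e; apply: val_inj.
by case: (ltngtP i j) => // /vlt; rewrite e ltnn.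
Qed.

Lemma coloring_of_partition (v : {ffun 'I_#|G| -> G}) (P : {set {set G}}) :
  ordering v -> clique_partition P ->
  exists (T : finType) (c : G -> T) (rk : G -> nat),
    [/\ #|T| = #|P|, injective rk, clique_coloring c,
        consistent v P -> forward_consistent rk c
      & backward_consistentb v P -> backward_consistent rk c].
Proof.
move=> /ordering_rank[rk [rkI rkv v_onto]] /andP[partP cliqueP].
have covP x : x \in cover P by rewrite (cover_partition partP) inE.
(* With the blocks themselves as palette, the number of colours is exactly [#|P|]. *)
pose T : finType := {B | B \in P}.
pose c x : T := exist _ (pblock P x) (pblock_mem (covP x)).
have cE x y : c x = c y -> same_class P x y by move=> [e]; apply/eqP.
exists T, c, rk; split => //.
- exact: card_sig.
- move=> x y xy [e].
  have /forall_inP/(_ x) := forall_inP cliqueP _ (pblock_mem (covP x)).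
  rewrite mem_pblock covP => /(_ isT)/forall_inP/(_ y).
  by rewrite e mem_pblock covP => /(_ isT)/implyP; apply.
- move=> con x y z; case: (v_onto x) (v_onto y) (v_onto z) => r -> [s ->] [t ->].
  rewrite !rkv => rst /cE e.
  by move/forallP/(_ r)/forallP/(_ s)/forallP/(_ t): con; rewrite rst e => /= /implyP.
- move=> con x y z; case: (v_onto x) (v_onto y) (v_onto z) => r -> [s ->] [t ->].
  rewrite !rkv => rst /cE e.
  by move/forallP/(_ r)/forallP/(_ s)/forallP/(_ t): con; rewrite rst e => /= /implyP.
Qed.

Lemma partition_of_coloring (T : finType) (c : G -> T) (rk : G -> nat) :
  injective rk -> clique_coloring c ->
  exists (v : {ffun 'I_#|G| -> G}) (P : {set {set G}}),
    [/\ ordering v, clique_partition P, #|P| <= #|T|,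
        forward_consistent rk c -> consistent v P
      & backward_consistent rk c -> backward_consistentb v P].
Proof.
move=> /rank_ordering[v ov vlt] cc.
pose P := preim_partition c [set: G].
have partP : partition P [set: G] by apply: preim_partitionP.
have eqvc : {in [set: G] & &, equivalence_rel (fun x y => c x == c y)}.
  by split=> // /eqP ->.
have sameP x y : same_class P x y -> c x = c y.
  rewrite /same_class eq_pblock ?(cover_partition partP) ?inE //; last first.
    by case/and3P: partP.
  by rewrite pblock_equivalence_partition ?inE // => /eqP.
exists v, P; split => //.
- apply/andP; split=> //; apply/forall_inP => B BP.
  apply/forall_inP => x xB; apply/forall_inP => y yB; apply/implyP => xy.
  have tP : trivIset P by case/and3P: partP.
  by apply: cc => //; apply: sameP; rewrite /same_class !(def_pblock tP BP).
(* Each block is the fibre of a colour that [c] attains. Colours not attained give no block, hence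
   only an inequality. *)
- have -> : P = [set c @^-1: [set a] | a in c @: [set: G]].
    rewrite -imset_comp; apply: eq_imset => x /=.
    by apply/setP=> y; rewrite !inE eq_sym.
  exact: leq_trans (leq_imset_card _ _) (max_card _).
- move=> con; apply/forallP => r; apply/forallP => s; apply/forallP => t.
  apply/implyP => /andP[rs st]; apply/implyP => /sameP e; apply/implyP.
  by apply: con e; rewrite !vlt.
- move=> con; apply/forallP => r; apply/forallP => s; apply/forallP => t.
  apply/implyP => /andP[rs st]; apply/implyP => /sameP e; apply/implyP.
  by apply: con e; rewrite !vlt.
Qed.

Lemma compthin_coloring :
  exists (T : finType) (c : G -> T) (rk : G -> nat),
    [/\ #|T| = compthin G, injective rk, clique_coloring c
      & forward_consistent rk c].
Proof.
rewrite /compthin; case: ex_minnP => k.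
move=> /existsP[v /existsP[P /and4P[ov cP /eqP <- con]]] _.
have [T [c [rk [cT rkI cc fc _]]]] := coloring_of_partition ov cP.
by exists T, c, rk; split=> //; apply: fc.
Qed.

Lemma comppthin_coloring :
  exists (T : finType) (c : G -> T) (rk : G -> nat),
    [/\ #|T| = comppthin G, injective rk, clique_coloring c,
        forward_consistent rk c & backward_consistent rk c].
Proof.
rewrite /comppthin; case: ex_minnP => k.
move=> /existsP[v /existsP[P /and4P[ov cP /eqP <- /andP[con1 con2]]]] _.
have [T [c [rk [cT rkI cc fc bc]]]] := coloring_of_partition ov cP.
by exists T, c, rk; split=> //; [apply: fc | apply: bc].
Qed.

Lemma compthin_le (T : finType) (c : G -> T) (rk : G -> nat) :
  injective rk -> clique_coloring c -> forward_consistent rk c ->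
  compthin G <= #|T|.
Proof.
move=> rkI cc fc; have [v [P [ov cP leP fcP _]]] := partition_of_coloring rkI cc.
rewrite /compthin; case: ex_minnP => k _ kmin; apply: leq_trans leP; apply: kmin.
by apply/existsP; exists v; apply/existsP; exists P; rewrite ov cP eqxx fcP.
Qed.

Lemma comppthin_le (T : finType) (c : G -> T) (rk : G -> nat) :
  injective rk -> clique_coloring c -> forward_consistent rk c ->
  backward_consistent rk c -> comppthin G <= #|T|.
Proof.
move=> rkI cc fc bc.
have [v [P [ov cP leP /(_ fc) fcP /(_ bc) bcP]]] := partition_of_coloring rkI cc.
rewrite /comppthin; case: ex_minnP => k _ kmin; apply: leq_trans leP; apply: kmin.
apply/existsP; exists v; apply/existsP; exists P; rewrite ov cP eqxx /=.
exact/andP.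
Qed.

End Translation.

(** * Rankings and colourings of the join *)

Section JoinColoring.
Variables (G1 G2 : sgraph) (rk1 : G1 -> nat) (rk2 : G2 -> nat).

(** The offset exceeds every rank in [G1], which puts all of [G2] strictly later. *)
Definition join_rank (u : join G1 G2) : nat :=
  match u with
  | inl x => rk1 x
  | inr y => (\max_x rk1 x).+1 + rk2 y
  end.

Lemma join_rank_lr x y : join_rank (inl x) < join_rank (inr y).
Proof. by rewrite /= addSn ltnS (leq_trans (leq_bigmax x)) ?leq_addr. Qed.

Lemma join_rank_rl x y : (join_rank (inr y) < join_rank (inl x)) = false.
Proof. by rewrite ltnNge ltnW // join_rank_lr. Qed.

Lemma join_rank_inj : injective rk1 -> injective rk2 -> injective join_rank.
Proof.
move=> rk1I rk2I [x|x] [y|y] e.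
- by congr inl; apply: rk1I.
- by have := join_rank_lr x y; rewrite e ltnn.
- by have := join_rank_lr y x; rewrite e ltnn.
- by congr inr; apply: rk2I; apply: addnI e.
Qed.

Section DisjointPalettes.
Variables (T1 T2 : eqType) (c1 : G1 -> T1) (c2 : G2 -> T2).

Definition join_coloring (u : join G1 G2) : T1 + T2 :=
  match u with inl x => inl (c1 x) | inr y => inr (c2 y) end.

Lemma join_clique_coloring :
  clique_coloring c1 -> clique_coloring c2 -> clique_coloring join_coloring.
Proof.
move=> cc1 cc2 [x|x] [y|y] //= xy [e]; [apply: cc1 e|apply: cc2 e].
  by apply: contraNneq xy => ->.
by apply: contraNneq xy => ->.
Qed.

(** Equal colours force [x] and [y] onto one side. If [z] is on the other, it is adjacent to [y] in
    the join; otherwise the condition is that of a single side. *)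
Lemma join_forward_consistent :
  forward_consistent rk1 c1 -> forward_consistent rk2 c2 ->
  forward_consistent join_rank join_coloring.
Proof.
move=> fc1 fc2 [x|x] [y|y] [z|z] //= lt [e]; first exact: fc1 lt e.
by apply: fc2 e; rewrite !ltn_add2l in lt.
Qed.

(** Here equal colours tie [y] to [z], and [x] is the vertex that may lie across. *)
Lemma join_backward_consistent :
  backward_consistent rk1 c1 -> backward_consistent rk2 c2 ->
  backward_consistent join_rank join_coloring.
Proof.
move=> bc1 bc2 [x|x] [y|y] [z|z] //= lt [e]; first exact: bc1 lt e.
by apply: bc2 e; rewrite !ltn_add2l in lt.
Qed.

End DisjointPalettes.

Section CompleteRight.
Variables (T : eqType) (c : G1 -> T) (a : T).

Definition extend_coloring (u : join G1 G2) : T :=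
  if u is inl x then c x else a.

(** The class of [a] may mix both sides, but vertices on different sides are adjacent in the
    join. *)
Lemma extend_clique_coloring :
  complete G2 -> clique_coloring c -> clique_coloring extend_coloring.
Proof.
move=> G2c cc [x|x] [y|y] //= xy e; [apply: cc e|apply: G2c].
  by apply: contraNneq xy => ->.
by apply: contraNneq xy => ->.
Qed.

(** Only [y] and [z] on the same side need an argument. In [G1], the lower rank of [x] puts it in
    [G1] too; in [G2], completeness makes [y] and [z] adjacent wherever [x] lies. *)
Lemma extend_forward_consistent :
  complete G2 -> forward_consistent rk1 c ->
  forward_consistent join_rank extend_coloring.
Proof.
move=> G2c fc x [y|y] [z|z] // /andP[xy yz].
- case: x xy => x xy; first by apply: fc; rewrite -/(join_rank (inl x)) xy.
  by rewrite join_rank_rl in xy.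
- by move=> _ _; apply: G2c; apply: contraTneq yz => ->; rewrite ltnn.
Qed.

End CompleteRight.
End JoinColoring.

(** [inl] embeds [G1] as an induced subgraph, and the conditions are universal over vertices, so
    they survive restriction. *)
Lemma compthin_join_ge (G1 G2 : sgraph) :
  compthin G1 <= compthin (join G1 G2).
Proof.
have [T [c [rk [<- rkI cc fc]]]] := compthin_coloring (join G1 G2).
apply: (@compthin_le G1 T (c \o inl) (rk \o inl)).
- by move=> x y /rkI[].
- by move=> x y xy; apply: (cc (inl x) (inl y)).
- by move=> x y z; apply: (fc (inl x) (inl y) (inl z)).
Qed.

Theorem theorem4p13 (G1 G2 : sgraph) :
  [/\ compthin (join G1 G2) <= compthin G1 + compthin G2,
      comppthin (join G1 G2) <= comppthin G1 + comppthin G2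
    & 0 < #|G1| -> complete G2 -> compthin (join G1 G2) = compthin G1].
Proof.
split.
- have [T1 [c1 [rk1 [<- rk1I cc1 fc1]]]] := compthin_coloring G1.
  have [T2 [c2 [rk2 [<- rk2I cc2 fc2]]]] := compthin_coloring G2.
  rewrite -card_sum; apply: (compthin_le (join_rank_inj rk1I rk2I)).
    exact: join_clique_coloring cc1 cc2.
  exact: join_forward_consistent.
- have [T1 [c1 [rk1 [<- rk1I cc1 fc1 bc1]]]] := comppthin_coloring G1.
  have [T2 [c2 [rk2 [<- rk2I cc2 fc2 bc2]]]] := comppthin_coloring G2.
  rewrite -card_sum; apply: (comppthin_le (join_rank_inj rk1I rk2I)).
  + exact: join_clique_coloring cc1 cc2.
  + exact: join_forward_consistent.
  + exact: join_backward_consistent.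
(* The vertex [x0] provides the colour reused on [G2]. For empty [G1] and nonempty [G2] equality
   fails: the left side is positive, the right side 0. *)
- move=> /card_gt0P[x0 _] G2c; apply/eqP; rewrite eqn_leq compthin_join_ge andbT.
  have [T [c [rk1 [<- rk1I cc fc]]]] := compthin_coloring G1.
  (* Any injective ranking of [G2] will do here, so the colouring is discarded. *)
  have [_ [_ [rk2 [_ rk2I _ _]]]] := compthin_coloring G2.
  apply: (compthin_le (join_rank_inj rk1I rk2I)).
    exact: extend_clique_coloring (c x0) G2c cc.
  exact: extend_forward_consistent.
Qed.
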